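(* Let $R$ be any ring. Then the category of right $R$-modules of finite length has CSL if and only if the right Gabriel quiver of $R$ is totally disconnected.
   Context: Rings are associative with identity (not necessarily commutative) and modules are unital. A category $\mathcal{C}$ of right $R$-modules (a full subcategory of the category of all right $R$-modules) ''has CSL'' (converse of Schur's Lemma) if every object $M$ of $\mathcal{C}$ whose endomorphism ring $\operatorname{End}(M_R)$ is a division ring is a simple module. The right Gabriel quiver (right Ext-quiver) of $R$ is the directed graph whose points are in bijective correspondence with the isomorphism classes of simple right $R$-modules, with an arrow $i \to j$ whenever the corresponding simple modules $S_i$ and $S_j$ satisfy $\operatorname{Ext}^1_R(S_i,S_j)\neq\{0\}$. It is called totally disconnected if there are no arrows between any two different points (loops are allowed); that is, $\operatorname{Ext}^1_R(S,T)=\{0\}$ for all nonisomorphic simple right $R$-modules $S$ and $T$. *)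

(* Defs.v *)
From HB Require Import structures.
From mathcomp Require Import all_boot all_algebra finmap.
From mathcomp Require Import mathcomp_extra boolp classical_sets functions.
From mathcomp Require Import cardinality fsbigop.

Set Implicit Arguments.
Unset Strict Implicit.
Unset Printing Implicit Defensive.

Import GRing.Theory.

Local Open Scope ring_scope.

(* A right R-module is a left module over the converse ring R^c, with x . r
   written (r : R^c) *: x.  Rings are [pzRingType]s: the zero ring is allowed.
   Everything below is stated for left A-modules, to be used with A := R^c. *)
Notation rmodType R := (lmodType R^c).

Section Linmap.
Variable A : pzRingType.
Implicit Types U V W : lmodType A.

Definition linmap U V : Type := {linear U -> V}.

HB.instance Definition _ U V := gen_eqMixin (linmap U V).
HB.instance Definition _ U V := gen_choiceMixin (linmap U V).

Definition linmap_zero U V : linmap U V := \0 : {linear U -> V}.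
Definition linmap_opp U V (f : linmap U V) : linmap U V :=
  \- f : {linear U -> V}.
Definition linmap_add U V (f g : linmap U V) : linmap U V :=
  f \+ g : {linear U -> V}.
Definition linmap_comp U V W (f : linmap V W) (g : linmap U V) : linmap U W :=
  f \o g : {linear U -> W}.
Definition linmap_id U : linmap U U := idfun : {linear U -> U}.

Lemma linmapP U V (f g : linmap U V) : f =1 g -> f = g.
Proof.
case: f g => [f [[fz] [fs]]] [g [[gz] [gs]]] /= /funext fg.
case: _ / fg in gz gs *.
by rewrite (Prop_irrelevance fz gz) (Prop_irrelevance fs gs).
Qed.

Fact linmap_addA U V : associative (@linmap_add U V).
Proof. by move=> f g h; apply: linmapP => x /=; rewrite addrA. Qed.
Fact linmap_addC U V : commutative (@linmap_add U V).
Proof. by move=> f g; apply: linmapP => x /=; rewrite addrC. Qed.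
Fact linmap_add0 U V : left_id (@linmap_zero U V) (@linmap_add U V).
Proof. by move=> f; apply: linmapP => x /=; rewrite add0r. Qed.
Fact linmap_addN U V :
  left_inverse (@linmap_zero U V) (@linmap_opp U V) (@linmap_add U V).
Proof. by move=> f; apply: linmapP => x /=; rewrite addNr. Qed.

HB.instance Definition _ U V := GRing.isZmodule.Build (linmap U V)
  (@linmap_addA U V) (@linmap_addC U V) (@linmap_add0 U V) (@linmap_addN U V).

Definition endo U : Type := linmap U U.
HB.instance Definition _ U := GRing.Zmodule.on (endo U).

Fact endo_mulA U : associative (@linmap_comp U U U).
Proof. by move=> f g h; apply: linmapP. Qed.
Fact endo_mul1l U : left_id (linmap_id U) (@linmap_comp U U U).
Proof. by move=> f; apply: linmapP. Qed.
Fact endo_mul1r U : right_id (linmap_id U) (@linmap_comp U U U).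
Proof. by move=> f; apply: linmapP. Qed.
Fact endo_mulDl U : left_distributive (@linmap_comp U U U) (@linmap_add U U).
Proof. by move=> f g h; apply: linmapP. Qed.
Fact endo_mulDr U : right_distributive (@linmap_comp U U U) (@linmap_add U U).
Proof. by move=> f g h; apply: linmapP => x /=; rewrite raddfD. Qed.

HB.instance Definition _ U := GRing.Zmodule_isPzRing.Build (endo U)
  (@endo_mulA U) (@endo_mul1l U) (@endo_mul1r U) (@endo_mulDl U)
  (@endo_mulDr U).

Definition isomorphic U V : Prop := exists f : linmap U V, bijective f.

End Linmap.

Definition division_ring (D : pzRingType) : Prop :=
  (1 : D) != 0 /\
  forall x : D, x != 0 -> exists y : D, x * y = 1 /\ y * x = 1.

(* A composition series is a finite chain of submodules from 0 to M in which no
   further submodule can be inserted, i.e. with simple factors.  Subsets are boolean predicates; with the classical axioms of [boolp], every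
   [M -> Prop] is of this form. *)
Section Length.
Variable A : pzRingType.
Implicit Types M : lmodType A.

Definition simple_module M : Prop :=
  (exists x : M, x != 0) /\
  forall N : {pred M}, GRing.submod_closed N -> N =i pred1 0 \/ N =i predT.

Definition maximal_in M (N N' : {pred M}) : Prop :=
  [/\ {subset N <= N'}, ~ (N =i N') &
      forall K : {pred M}, GRing.submod_closed K ->
        {subset N <= K} -> {subset K <= N'} -> K =i N \/ K =i N'].

Definition composition_series M (n : nat) (N : nat -> {pred M}) : Prop :=
  [/\ forall i, (i <= n)%N -> GRing.submod_closed (N i),
      N 0%N =i pred1 0, N n =i predT &
      forall i, (i < n)%N -> maximal_in (N i) (N i.+1)].

Definition finite_length M : Prop :=
  exists (n : nat) (N : nat -> {pred M}), composition_series n N.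

Definition has_CSL (C : lmodType A -> Prop) : Prop :=
  forall M, C M -> division_ring (endo M) -> simple_module M.

End Length.

Section Free.
Variables (A : pzRingType) (X : choiceType).

Definition finsupp_fun : {pred X -> A^o} :=
  [pred f | `[< finite_set [set x | f x != 0]%classic >]].

Fact finsupp_funP (f : X -> A^o) :
  reflect (exists D : {fset X}, forall x, x \notin D -> f x = 0)
          (f \in finsupp_fun).
Proof.
apply: (iffP (asboolP _)) => [/finite_fsetP[D fD]|[D fD]].
  exists D => x; apply: contraNeq => fx.
  by have : [set` D]%classic x by rewrite -fD.
apply: (@sub_finite_set _ _ [set` D]%classic); last exact: finite_fset.
by move=> x /=; apply: contraNT => /fD ->.
Qed.

Fact finsupp_fun_submod : GRing.submod_closed finsupp_fun.
Proof.
split; first by apply/finsupp_funP; exists fset0.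
move=> a f g /finsupp_funP[D fD] /finsupp_funP[E gE].
apply/finsupp_funP; exists (D `|` E)%fset => x.
rewrite in_fsetU negb_or => /andP[xD xE].
by rewrite -[LHS]/(a *: f x + g x) fD // gE // scaler0 addr0.
Qed.
HB.instance Definition _ :=
  GRing.isSubmodClosed.Build A (X -> A^o) finsupp_fun finsupp_fun_submod.

(* The free A-module on X: finitely supported families of coefficients. *)
Record free_mod : Type := FreeMod {
  free_mod_val :> X -> A^o;
  free_mod_valP : free_mod_val \in finsupp_fun
}.
HB.instance Definition _ := [isSub for free_mod_val].
HB.instance Definition _ := [Choice of free_mod by <:].
HB.instance Definition _ := [SubChoice_isSubLmodule of free_mod by <:].

End Free.

Section Kernel.
Variables (A : pzRingType) (U V : lmodType A) (f : linmap U V).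

Definition in_kernel : {pred U} := [pred x | f x == 0].

Fact in_kernel_submod : GRing.submod_closed in_kernel.
Proof.
split=> [|a x y]; rewrite !inE ?raddf0 // => /eqP fx /eqP fy.
by rewrite linearP fx fy scaler0 addr0.
Qed.
HB.instance Definition _ :=
  GRing.isSubmodClosed.Build A U in_kernel in_kernel_submod.

Record ker_mod : Type :=
  KerMod { ker_mod_val :> U; ker_mod_valP : ker_mod_val \in in_kernel }.
HB.instance Definition _ := [isSub for ker_mod_val].
HB.instance Definition _ := [Choice of ker_mod by <:].
HB.instance Definition _ := [SubChoice_isSubLmodule of ker_mod by <:].

Definition ker_mod_incl : linmap ker_mod U := val : {linear ker_mod -> U}.

End Kernel.

Section Ext.
Variable A : pzRingType.
Implicit Types S T : lmodType A.

(* The canonical free presentation 0 -> K -> F -> S -> 0 of S,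
   with F free on the underlying set of S. *)
Definition free_mod_eval_fun S (f : free_mod A S) : S :=
  \sum_(x \in [set: S]) (f x : A) *: x.

Fact free_mod_eval_linear S : linear (@free_mod_eval_fun S).
Proof.
move=> a f g; have /finsupp_funP[D fD] := free_mod_valP f.
have /finsupp_funP[E gE] := free_mod_valP g.
pose F := (D `|` E)%fset.
have evalE (h : free_mod A S) : (forall x, x \notin F -> h x = 0) ->
    free_mod_eval_fun h = \sum_(x <- F) (h x : A) *: x.
  move=> hF; rewrite /free_mod_eval_fun (fsbigTE F) //.
  by move=> x /hF ->; rewrite scale0r.
have fF x : x \notin F -> f x = 0 by rewrite in_fsetU negb_or => /andP[/fD].
have gF x : x \notin F -> g x = 0 by rewrite in_fsetU negb_or => /andP[_ /gE].
have valE x : (a *: f + g : free_mod A S) x = a * f x + g x by [].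
have fgF x : x \notin F -> (a *: f + g : free_mod A S) x = 0.
  by move=> xF; rewrite valE fF // gF // mulr0 addr0.
rewrite (evalE _ fgF) (evalE _ fF) (evalE _ gF) /= scaler_sumr -big_split /=.
by apply: eq_bigr => x _; rewrite scalerA -scalerDl.
Qed.
HB.instance Definition _ S :=
  GRing.isLinear.Build A (free_mod A S) S *:%R (@free_mod_eval_fun S)
    (@free_mod_eval_linear S).

Definition free_mod_eval S : linmap (free_mod A S) S :=
  @free_mod_eval_fun S : {linear free_mod A S -> S}.

Definition syzygy S : lmodType A := ker_mod (free_mod_eval S).

Definition extendable S T : {pred linmap (syzygy S) T} :=
  [pred f | `[< exists g : linmap (free_mod A S) T,
                  f = linmap_comp g (ker_mod_incl (free_mod_eval S)) >]].

Fact extendable_zmod S T : zmod_closed (@extendable S T).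
Proof.
split; first by apply/asboolP; exists 0; apply: linmapP.
move=> _ _ /asboolP[f ->] /asboolP[g ->].
by apply/asboolP; exists (f - g); apply: linmapP.
Qed.
HB.instance Definition _ S T :=
  GRing.isZmodClosed.Build (linmap (syzygy S) T) (@extendable S T)
    (@extendable_zmod S T).

(* Ext^1(S, T) is the cokernel of the restriction map
   Hom(F, T) -> Hom(K, T).  Since F is projective, this is the degree-one
   derived functor of Hom(-, T) at S. *)
Definition Ext1 S T : zmodType := ring_quotient.Quotient.quot (@extendable S T).

(* The arrow relation of the Gabriel quiver, on representatives of the
   isomorphism classes of simple modules. *)
Definition quiver_arrow S T : Prop := exists e : Ext1 S T, e != 0.

End Ext.

Definition right_quiver_totally_disconnected (R : pzRingType) : Prop :=
  forall S T : rmodType R, simple_module S -> simple_module T ->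
    ~ isomorphic S T -> ~ quiver_arrow S T.

(* Main.v *)
(* Let F be free on a simple module S, with K the kernel of F -> S.

   If some f : K -> T with T simple and not isomorphic to S does not extend to
   F, then M = F / ker f is a nonsplit extension of S by T whose only submodules
   are 0, T and M, so by Schur's lemma every nonzero endomorphism of M is
   bijective although M is not simple.

   Conversely, let M have finite length and a division ring of endomorphisms,
   and let N be the last proper term of a composition series, S = M / N.  A
   nonzero map S -> N would give a nonzero endomorphism of M of square zero, so
   Hom(S, N) = 0.  When there are no arrows out of S to other points this forces
   M -> S to split, and the resulting idempotent endomorphism must be the
   identity, so N = 0. *)
Require Import Defs.
From HB Require Import structures.
From mathcomp Require Import all_boot all_algebra finmap.
From mathcomp Require Import boolp fsbigop.

Set Implicit Arguments.
Unset Strict Implicit.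
Unset Printing Implicit Defensive.

Import GRing.Theory.

Local Open Scope ring_scope.
Local Open Scope quotient_scope.

(** * Linear maps given by their graphs, and quotient modules *)

Section LinearGraphs.
Variable A : pzRingType.
Implicit Types U V W : lmodType A.

Lemma linmap_exists U V (f : U -> V) :
  linear f -> exists g : linmap U V, g =1 f.
Proof.
move=> fL; pose l := GRing.isLinear.Build A U V *:%R f fL.
by pose g : {linear U -> V} := HB.pack f l; exists g.
Qed.

Definition linear_rel U V (r : U -> V -> Prop) : Prop :=
  forall a u v u' v', r u v -> r u' v' -> r (a *: u + u') (a *: v + v').

(** Two values at the same [u] differ by a value at 0, so single-valuedness need only be checked
    there. Maps can thus be given by a relation, without choosing representatives. *)
Lemma linmap_of_graph U V (r : U -> V -> Prop) : linear_rel r ->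
  (forall u, exists v, r u v) -> (forall v, r 0 v -> v = 0) ->
  exists g : linmap U V, forall u v, r u v <-> g u = v.
Proof.
move=> rL /choice[g rg] r0.
have rE u v : r u v -> g u = v.
  move=> ruv; have := rL (-1) _ _ _ _ ruv (rg u).
  by rewrite !scaleN1r addNr addrC => /r0/subr0_eq.
have [|h hg] := @linmap_exists _ _ g.
  by move=> a u v; apply: rE; apply: rL.
by exists h => u v; rewrite hg; split=> [/rE|<-].
Qed.

Lemma isomorphic_of_graph U V (r : U -> V -> Prop) : linear_rel r ->
  (forall u, exists v, r u v) -> (forall v, exists u, r u v) ->
  (forall v, r 0 v -> v = 0) -> (forall u, r u 0 -> u = 0) ->
  isomorphic U V.
Proof.
move=> rL rU rV r0V r0U.
have [g gP] := linmap_of_graph rL rU r0V.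
have [h hP] := @linmap_of_graph V U (fun v u => r u v)
  (fun a _ _ _ _ ru rv => rL a _ _ _ _ ru rv) rV r0U.
by exists g; exists h => x; [apply/hP/gP|apply/gP/hP].
Qed.

Lemma linmap_factor U V W (p : linmap U V) (f : linmap U W) :
  (forall v, exists u, p u = v) -> (forall u, p u = 0 -> f u = 0) ->
  exists g : linmap V W, forall u, g (p u) = f u.
Proof.
move=> p_surj pf.
have [|v|w [u [/pf <- <-]]|g gP] :=
  @linmap_of_graph V W (fun v w => exists u, p u = v /\ f u = w) => //.
- move=> a _ _ _ _ [u [<- <-]] [v [<- <-]].
  by exists (a *: u + v); rewrite !linearP.
- by have [u pu] := p_surj v; exists (f u), u.
by exists g => u; apply/gP; exists u.
Qed.

Lemma submod_closed_preim U V (h : linmap U V) (P : {pred V}) :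
  GRing.submod_closed P -> GRing.submod_closed [pred u | h u \in P].
Proof.
move=> [P0 PL].
by split=> [|a u v uP vP]; rewrite inE ?raddf0 // linearP; exact: PL.
Qed.

Lemma submod_closed_image U V (h : linmap U V) (P : {pred U}) :
  GRing.submod_closed P ->
  GRing.submod_closed [pred v | `[< exists2 u, u \in P & h u = v >]].
Proof.
move=> [P0 PL]; split; first by apply/asboolP; exists 0; rewrite ?raddf0.
move=> a _ _ /asboolP[u uP <-] /asboolP[v vP <-].
by apply/asboolP; exists (a *: u + v); [exact: PL|rewrite linearP].
Qed.

(** The additive quotient by [L] gets the scalar action computed on representatives; stability of
    [L] under scalars makes the result independent of them. *)
Lemma quotient_exists V (L : {pred V}) : GRing.submod_closed L ->
  exists (Q : lmodType A) (p : linmap V Q),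
    (forall q, exists v, p v = q) /\ (forall v, (p v == 0) = (v \in L)).
Proof.
move=> LL; have [_ LZ] := GRing.submod_closed_semi LL.
pose m := GRing.isZmodClosed.Build V L (GRing.submod_closedB LL).
pose L' : zmodClosed V := HB.pack L m.
pose Q := {ideal_quot L'}.
pose sc (a : A) (q : Q) : Q := \pi_Q (a *: repr q)%R.
have scE a v : sc a (\pi_Q v) = \pi_Q (a *: v)%R.
  apply/eqP; rewrite -Quotient.idealrBE -scalerBr.
  by apply: LZ; rewrite -[_ \in L]/(_ \in L') Quotient.idealrBE reprK.
have piD : {morph \pi_Q : u v / (u + v)%R}.
  by move=> u v; rewrite -[RHS]/(Quotient.add _ _) Quotient.pi_add.
have piS (q : Q) : exists v, q = \pi_Q v by exists (repr q); rewrite reprK.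
have scA a b v : sc a (sc b v) = sc (a * b) v.
  by have [w ->] := piS v; rewrite !scE scalerA.
have sc1 : left_id 1 sc by move=> v; have [w ->] := piS v; rewrite scE scale1r.
have scDr : right_distributive sc +%R.
  move=> a u v; have [u' ->] := piS u; have [v' ->] := piS v.
  by rewrite -piD !scE -piD scalerDr.
have scDl v : {morph sc^~ v : a b / a + b}.
  by move=> a b; have [w ->] := piS v; rewrite !scE -piD scalerDl.
pose ml := GRing.Zmodule_isLmodule.Build A Q scA sc1 scDr scDl.
pose QM : lmodType A := HB.pack Q ml.
have [|p pE] := @linmap_exists V QM \pi_Q.
  by move=> a u v; rewrite piD -scE.
exists QM, p; split=> [q|v]; first by exists (repr q); rewrite pE; apply: reprK.
(* Writing the zero of the quotient as [p 0] turns the claim into an equality of classes. *)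
have <- : p 0 = 0 by exact: raddf0.
by rewrite !pE -[LHS]/(v == 0 %[mod Q]) -Quotient.idealrBE subr0.
Qed.

Lemma maximal_in_exists V (N N' : {pred V}) :
  maximal_in N N' -> exists2 v, v \in N' & v \notin N.
Proof.
case=> NN' neq _; apply: contrapT => no; apply: neq => v.
apply/idP/idP => [/NN'//|vN']; apply: contraT => vN.
by case: no; exists v.
Qed.

End LinearGraphs.

(** * Free modules, their projectivity, and cocycles for [Ext1] *)

Section FreeModules.
Variable A : pzRingType.

Section Basis.
Variable X : choiceType.
Implicit Types (f : free_mod A X) (D E : {fset X}).

Lemma free_mod_supp f : exists D : {fset X}, forall x, x \notin D -> f x = 0.
Proof. exact/finsupp_funP/free_mod_valP. Qed.

Fact free_delta_subproof (x : X) :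
  (fun y => (y == x)%:R : A^o) \in @finsupp_fun A X.
Proof.
by apply/finsupp_funP; exists [fset x]%fset => y; rewrite in_fset1 => /negPf ->.
Qed.
Definition free_delta (x : X) : free_mod A X :=
  FreeMod (free_delta_subproof x).

Lemma free_mod_sumE (s : seq X) (F : X -> free_mod A X) y :
  (\sum_(x <- s) F x) y = \sum_(x <- s) F x y.
Proof. by elim/big_rec2: _ => // x a b _ <-. Qed.

Lemma free_mod_expand f D : (forall x, x \notin D -> f x = 0) ->
  f = \sum_(x <- D) (f x : A) *: free_delta x.
Proof.
move=> fD; apply/val_inj/funext => y /=; rewrite [RHS]free_mod_sumE.
under eq_bigr do rewrite -[_ y]/((f _ : A) * (y == _)%:R).
have [yD|yD] := boolP (y \in D); last first.
  rewrite fD // big_seq big1 // => x xD.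
  by case: eqP yD => [->|_ _]; rewrite ?xD // mulr0.
rewrite (bigD1_seq y) ?fset_uniq //= eqxx mulr1 big1 ?addr0 // => x.
by rewrite eq_sym => /negPf ->; rewrite mulr0.
Qed.

(** The sum does not depend on the finite set [D] as long as [D] contains the support. Allowing any
    such [D] lets two elements be added over a common one. *)
Lemma free_mod_universal (U : lmodType A) (u : X -> U) :
  exists g : linmap (free_mod A X) U, forall f D,
    (forall x, x \notin D -> f x = 0) ->
    g f = \sum_(x <- D) (f x : A) *: u x.
Proof.
pose r f v := exists2 D : {fset X}, (forall x, x \notin D -> f x = 0) &
  v = \sum_(x <- D) (f x : A) *: u x.
have widen f D E : (forall x, x \notin D -> f x = 0) ->
    (forall x, x \in D -> x \in E) ->
    \sum_(x <- D) (f x : A) *: u x = \sum_(x <- E) (f x : A) *: u x.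
  move=> fD DE; apply: big_fset_incl; first exact/fsubsetP.
  by move=> x _ /fD ->; rewrite scale0r.
have [|f|_ [D _ ->]|g gP] := @linmap_of_graph A _ U r.
- move=> a f _ g _ [D fD ->] [E gE ->]; exists (D `|` E)%fset.
    move=> x; rewrite in_fsetU negb_or => /andP[xD xE].
    by rewrite -[LHS]/(a * f x + g x) fD // gE // mulr0 addr0.
  rewrite (widen f D (D `|` E)%fset) // => [|x xD]; last by rewrite in_fsetU xD.
  rewrite (widen g E (D `|` E)%fset) // => [|x xE]; last first.
    by rewrite in_fsetU xE orbT.
  rewrite scaler_sumr -big_split /=; apply: eq_bigr => x _.
  by rewrite scalerA -scalerDl.
- by have [D fD] := free_mod_supp f; exists (\sum_(x <- D) (f x : A) *: u x), D.
- by apply: big1 => x _; rewrite scale0r.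
by exists g => f D fD; apply/gP; exists D.
Qed.

Lemma free_mod_projective (U V : lmodType A) (p : linmap U V)
    (h : linmap (free_mod A X) V) : (forall v, exists u, p u = v) ->
  exists g : linmap (free_mod A X) U, forall f, p (g f) = h f.
Proof.
move=> p_surj; have [u uP] := choice (fun x => p_surj (h (free_delta x))).
have [g gE] := free_mod_universal u; exists g => f.
have [D fD] := free_mod_supp f; rewrite (gE _ _ fD) {2}(free_mod_expand fD).
by rewrite !linear_sum; apply: eq_bigr => x _; rewrite !linearZ /= uP.
Qed.

End Basis.

Implicit Types S T : lmodType A.

Lemma free_mod_eval_surj S s : exists f, free_mod_eval S f = s.
Proof.
exists (free_delta s); rewrite -[LHS]/(free_mod_eval_fun (free_delta s)).
rewrite /free_mod_eval_fun (fsbigTE [fset s]%fset).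
  by rewrite big_seq_fset1 /= eqxx scale1r.
by move=> x; rewrite in_fset1 /= => /negPf ->; rewrite scale0r.
Qed.

Lemma syzygyP S f :
  free_mod_eval S f = 0 <-> exists k : syzygy S, ker_mod_val k = f.
Proof.
split=> [f0|[k <-]]; last by apply/eqP; exact: ker_mod_valP.
have fK : f \in in_kernel (free_mod_eval S) by rewrite inE f0.
by exists (KerMod fK).
Qed.

(** A class in the cokernel is nonzero exactly when its representatives do not extend to the free
    module; from here on cocycles on the syzygy replace the quotient group. *)
Lemma quiver_arrowP S T : quiver_arrow S T <->
  exists f : linmap (syzygy S) T, forall g : linmap (free_mod A S) T,
    exists k, g (ker_mod_val k) <> f k.
Proof.
have piE0 f : (\pi_(Ext1 S T) f == 0) = (f \in @extendable A S T).
  by rewrite piE Quotient.equivE subr0.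
split=> [[e e0]|[f fP]].
  exists (repr e) => g; apply: contrapT => gf.
  case/negP: e0; rewrite -[e]reprK piE0; apply/asboolP; exists g.
  by apply: linmapP => k; apply: contrapT => ne; apply: gf; exists k => /esym.
exists (\pi f); rewrite piE0; apply/asboolP => -[g fg].
by have [k] := fP g; rewrite fg; apply.
Qed.

End FreeModules.

(** * Splitting surjections onto S in the absence of arrows *)

Section Splitting.
Variables (A : pzRingType) (S : lmodType A).
Hypothesis S_no_arrow : forall T : lmodType A, simple_module T ->
  ~ isomorphic S T -> ~ quiver_arrow S T.

Local Notation F := (free_mod A S).
Local Notation evalS := (free_mod_eval S).

(* A map f : F -> M with f(K) <= N encodes a homomorphism S -> M / N, so the
   fourth hypothesis says Hom(S, N' / N) = 0, and the lemma says that every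
   homomorphism S -> M / N' lifts to M / N. *)
Lemma correction_step (M : lmodType A) (N N' : {pred M}) (f : linmap F M) :
  GRing.submod_closed N -> GRing.submod_closed N' -> maximal_in N N' ->
  (forall g : linmap F M, (forall x, evalS x = 0 -> g x \in N) ->
    (forall x, g x \in N') -> forall x, g x \in N) ->
  (forall x, evalS x = 0 -> f x \in N') ->
  exists2 g : linmap F M, forall x, g x \in N' &
    forall x, evalS x = 0 -> f x - g x \in N.
Proof.
move=> NS N'S NN' noN fN'.
have [Q [p [p_surj pN]]] := quotient_exists NS.
have [Q' [p' [_ pN']]] := quotient_exists N'S.
have [[subN _ maxN] [v0 v0N' v0N]] := (NN', maximal_in_exists NN').
(* [q] is the projection M / N -> M / N', so its kernel [T] is N' / N, which is simple by maximality
   of N in N'. *)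
have [|q qp] := linmap_factor (f := p') p_surj.
  by move=> v /eqP; rewrite pN => /subN; rewrite -pN' => /eqP.
pose T : lmodType A := ker_mod q.
have qN' v : (p v \in in_kernel q) = (v \in N') by rewrite inE qp pN'.
have T_lift (t : T) : exists2 v, p v = ker_mod_val t & v \in N'.
  have [v pv] := p_surj (ker_mod_val t).
  by exists v => //; rewrite -qN' pv; exact: ker_mod_valP.
have T_ne0 : exists t : T, t != 0.
  have tP : p v0 \in in_kernel q by rewrite qN'.
  exists (KerMod tP); apply: contraNneq v0N.
  move=> /(congr1 (@ker_mod_val _ _ _ q)).
  by rewrite -pN => /= ->.
have T_simple : simple_module T.
  split=> // L [L0 LL].
  pose K : {pred M} :=
    [pred v | `[< exists2 t : T, ker_mod_val t = p v & t \in L >]].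
  have KS : GRing.submod_closed K.
    split; first by apply/asboolP; exists 0; rewrite ?raddf0.
    move=> a u v /asboolP[s su sL] /asboolP[t tv tL].
    apply/asboolP; exists (a *: s + t); last exact: LL.
    by rewrite linearP -su -tv.
  have NK : {subset N <= K}.
    move=> v; rewrite -pN => /eqP pv0.
    by apply/asboolP; exists 0; rewrite ?pv0.
  have KN' : {subset K <= N'}.
    by move=> v /asboolP[t tv _]; rewrite -qN' -tv; exact: ker_mod_valP.
  have [KN|KN] := maxN K KS NK KN'; [left|right] => t.
    apply/idP/eqP => [tL|-> //].
    have [v pv _] := T_lift t; apply: val_inj => /=; rewrite -pv.
    by apply/eqP; rewrite pN -KN; apply/asboolP; exists t.
  have [v pv] := T_lift t; rewrite -KN => /asboolP[s sv sL].
  suff -> : t = s by rewrite sL.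
  by apply: val_inj; rewrite /= sv.
have lift_to_N' (h : linmap F T) :
    exists2 g : linmap F M, forall x, p (g x) = ker_mod_val (h x) &
    forall x, g x \in N'.
  have [g gP] := free_mod_projective (linmap_comp (ker_mod_incl q) h) p_surj.
  exists g => // x; rewrite -qN' gP; exact: ker_mod_valP.
(* An isomorphism S -> T, lifted to a map F -> N', would be a nonzero homomorphism S -> N' / N,
   against [noN]. *)
have ST : ~ isomorphic S T.
  case=> h [h' hK h'K].
  have [g pg gN'] := lift_to_N' (linmap_comp h evalS).
  have [t /eqP t0] := T_ne0; apply: t0.
  have [x xt] := free_mod_eval_surj (h' t).
  apply: val_inj => /=; rewrite -[t]h'K -xt -pg.
  apply/eqP; rewrite pN; apply: noN => // y y0.
  by rewrite -pN pg /= y0 raddf0.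
(* Modulo N, [f] restricts on K to a cocycle [r] with values in T. As Ext^1(S, T) = 0, it extends to
   some [h] on F, and a lift of [h] to N' is the required correction. *)
have rP (k : syzygy S) : p (f (ker_mod_val k)) \in in_kernel q.
  by rewrite qN'; apply/fN'/syzygyP; exists k.
have [|r rE] := @linmap_exists A (syzygy S) T (fun k => KerMod (rP k)).
  by move=> a k l; apply: val_inj; rewrite /= !linearP.
have [h hr] : exists h : linmap F T,
    forall k : syzygy S, h (ker_mod_val k) = r k.
  apply: contrapT => noh; apply: (S_no_arrow T_simple ST).
  apply/quiver_arrowP; exists r => g; apply: contrapT => nok; apply: noh.
  by exists g => k; apply: contrapT => ne; apply: nok; exists k.
have [g pg gN'] := lift_to_N' h; exists g => // _ /syzygyP[k <-].
by rewrite -pN raddfB /= pg hr rE subrr.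
Qed.

(** A map S -> N n / N i.+1 lifts to N n / N i by [correction_step], so the vanishing of Hom(S, N n)
    passes to every N n / N i. Hence no factor of the chain is isomorphic to S, and the identity of
    S can be lifted past one factor at a time. *)
Lemma split_of_no_hom (M : lmodType A) (p : linmap M S) (n : nat)
    (N : nat -> {pred M}) :
  (forall s, exists v, p v = s) -> N 0%N =i pred1 0 ->
  (forall v, (p v == 0) = (v \in N n)) ->
  (forall i, (i <= n)%N -> GRing.submod_closed (N i)) ->
  (forall i, (i < n)%N -> maximal_in (N i) (N i.+1)) ->
  (forall h : linmap S M, (forall s, p (h s) = 0) -> forall s, h s = 0) ->
  exists h : linmap S M, forall s, p (h s) = s.
Proof.
move=> p_surj N0 pN NS Nmax no_hom.
have NsubNn i : (i <= n)%N -> {subset N i <= N n}.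
  move=> le_in; rewrite -(subKn le_in); move: (leq_subr i n).
  elim: (n - i)%N => [_ v|d IHd lt_dn v Nv]; first by rewrite subn0.
  apply: IHd (ltnW lt_dn) _ _.
  have [|sub _ _] := Nmax (n - d.+1)%N.
    by rewrite ltn_subrL (leq_trans _ lt_dn).
  by rewrite -subnSK //; apply: sub.
(* Hom(S, N n / N i) = 0, by induction on i. *)
have noN i : (i <= n)%N -> forall g : linmap F M,
    (forall x, evalS x = 0 -> g x \in N i) ->
    (forall x, g x \in N n) -> forall x, g x \in N i.
  elim: i => [_ g g0 gn x|i IHi lt_in g gi gn x].
    have [|h hE] := linmap_factor (f := g) (@free_mod_eval_surj A S).
      by move=> y /g0; rewrite N0 => /eqP.
    rewrite N0 -hE; apply/eqP/no_hom => s.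
    by have [y <-] := free_mod_eval_surj s; apply/eqP; rewrite hE pN.
  have [|h hN hg] :=
    correction_step (NS i (ltnW lt_in)) (NS _ lt_in) (Nmax i lt_in) _ gi.
    move=> h hi hS; apply: IHi (ltnW lt_in) _ hi _ => y.
    exact: NsubNn (hS y).
  have ghN y : (g - h) y \in N n.
    have [_ NnB] := GRing.submod_closedB (NS n (leqnn n)).
    exact: NnB (gn y) (NsubNn _ lt_in _ (hN y)).
  have [sub _ _] := Nmax i lt_in; have [_ NiL] := NS _ lt_in.
  have := NiL 1 _ _ (sub _ (IHi (ltnW lt_in) (g - h) hg ghN x)) (hN x).
  by rewrite scale1r subrK.
(* The identity of S = M / N n lifts step by step to M / N (n - d). *)
have lift_eval d : (d <= n)%N -> exists2 g : linmap F M,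
    forall x, p (g x) = evalS x &
    forall x, evalS x = 0 -> g x \in N (n - d)%N.
  elim: d => [_|d IHd lt_dn].
    have [g gE] := free_mod_projective evalS p_surj.
    by exists g => // x x0; rewrite subn0 -pN gE x0.
  have [g gE gN] := IHd (ltnW lt_dn).
  have lt_n : (n - d.+1 < n)%N by rewrite ltn_subrL (leq_trans _ lt_dn).
  have eq_n : (n - d = (n - d.+1).+1)%N by rewrite subnSK.
  rewrite eq_n in gN.
  have [|h hN hg] :=
    correction_step (NS _ (ltnW lt_n)) (NS _ lt_n) (Nmax _ lt_n) _ gN.
    move=> h hi hS; apply: noN (ltnW lt_n) _ hi _ => y.
    exact: NsubNn (hS y).
  (* The correction [h] takes values in N (n - d), inside the kernel N n of [p], so the composite
     with [p] is unchanged. *)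
  exists (g - h) => // x; rewrite -[(g - h) x]/(g x - h x) raddfB /= gE.
  suff /eqP -> : p (h x) == 0 by rewrite subr0.
  by rewrite pN; apply: NsubNn (hN x).
have [g gE gN] := lift_eval n (leqnn n); rewrite subnn in gN.
have [|h hE] := linmap_factor (f := g) (@free_mod_eval_surj A S).
  by move=> x /gN; rewrite N0 => /eqP.
by exists h => s; have [x <-] := free_mod_eval_surj s; rewrite hE gE.
Qed.

End Splitting.

(** * From absence of arrows to the converse of Schur's lemma *)

Section ConverseSchur.
Variable A : pzRingType.
Implicit Types S T M : lmodType A.

Lemma simple_quotient M (N N' : {pred M}) (Q : lmodType A) (p : linmap M Q) :
  maximal_in N N' -> N' =i predT -> (forall q, exists v, p v = q) ->
  (forall v, (p v == 0) = (v \in N)) -> simple_module Q.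
Proof.
move=> NN' N'T p_surj pN; split.
  by have [v _ vN] := maximal_in_exists NN'; exists (p v); rewrite pN.
move=> L LS; have [_ _ maxN] := NN'; have [L0 _] := LS.
pose K : {pred M} := [pred v | p v \in L].
have KS : GRing.submod_closed K by exact: submod_closed_preim.
have [||KN|KN] := maxN K KS; [| |left|right].
- by move=> v; rewrite -pN inE => /eqP ->.
- by move=> v; rewrite N'T.
- by move=> q; have [v <-] := p_surj q; rewrite [RHS]pN -KN.
- by move=> q; have [v <-] := p_surj q; rewrite [LHS]KN N'T.
Qed.

Lemma has_CSL_of_no_arrow :
  (forall S T, simple_module S -> simple_module T ->
    ~ isomorphic S T -> ~ quiver_arrow S T) ->
  has_CSL (fun M => finite_length M).
Proof.
move=> no_arrow M [n [N [NS N0 NT Nmax]]] [one_ne0 inv].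
case: n => [|n] in NS NT Nmax *.
  (* A series of length 0 forces M = 0, where the identity is the zero map. *)
  case/eqP: one_ne0; apply: linmapP => v; apply/eqP.
  by rewrite -[_ == _]N0 NT.
have [Q [p [p_surj pN]]] := quotient_exists (NS n (leqnSn n)).
have Nn := Nmax n (leqnn _).
have Q_simple := simple_quotient Nn NT p_surj pN.
have [[q q0] _] := Q_simple.
have [v pv] := p_surj q.
have endo_ne0 (h : linmap Q M) : h q <> 0 -> (linmap_comp h p : endo M) != 0.
  move=> hq; apply: contra_not_neq hq => hp0.
  by rewrite -pv -[LHS]/(linmap_comp h p v) hp0.
have [no_hom|] := pselect (forall h : linmap Q M,
    (forall s, p (h s) = 0) -> forall s, h s = 0); last first.
  move=> /existsNP[h /not_implyP[ph /existsNP[s hs]]]; exfalso.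
  pose e : endo M := linmap_comp h p.
  have ee : e * e = 0 by apply: linmapP => u /=; rewrite ph raddf0.
  have [|f [_ fe]] := inv e.
    have [u pu] := p_surj s; apply: contra_not_neq hs => e0.
    by rewrite -pu -[LHS]/(e u) e0.
  suff e0 : e = 0 by case/eqP: one_ne0; rewrite -fe e0 mulr0.
  by rewrite -[e]mul1r -fe -mulrA ee mulr0.
have [h ph] := split_of_no_hom (no_arrow Q ^~ Q_simple) p_surj N0 pN
  (fun i le_in => NS i (leqW le_in)) (fun i lt_in => Nmax i (leqW lt_in))
  no_hom.
pose e : endo M := linmap_comp h p.
have [|f [_ fe]] := inv e.
  by apply: endo_ne0 => hq; case/eqP: q0; rewrite -[q]ph hq raddf0.
have e1 : e = 1.
  rewrite -fe -[e in LHS]mul1r -fe -mulrA; congr (_ * _).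
  by apply: linmapP => u; rewrite /= ph.
(* [e] kills N n, the kernel of [p], so e = 1 gives N n = 0; maximality of N n in M then says that M
   is simple. *)
have Nn0 u : (u \in N n) = (u == 0).
  apply/idP/eqP => [|->]; last by have [] := NS n (leqnSn n).
  rewrite -pN => /eqP pu.
  by rewrite -[u]/((1 : endo M) u) -e1 /= pu raddf0.
split; first by exists v; apply: contraNneq q0 => v0; rewrite -pv v0 raddf0.
have [_ _ maxN] := Nn; move=> K KS; have [K0 _] := KS.
have [||KN|KN] := maxN K KS; [| |left|right].
- by move=> u; rewrite Nn0 => /eqP ->.
- by move=> u; rewrite NT.
- by move=> u; rewrite KN Nn0.
- by move=> u; rewrite KN NT.
Qed.

Lemma simple_image (U T : lmodType A) (P : {pred U}) (h : linmap U T) :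
  simple_module T -> GRing.submod_closed P ->
  (forall u, u \in P -> h u = 0) \/ (forall t, exists2 u, u \in P & h u = t).
Proof.
move=> [_ simT] PS.
pose I : {pred T} := [pred t | `[< exists2 u, u \in P & h u = t >]].
have IS : GRing.submod_closed I by exact: submod_closed_image.
have [I0|IT] := simT I IS; [left=> u uP|right=> t].
  by apply/eqP; rewrite -[_ == _]I0; apply/asboolP; exists u.
by have : t \in I by [rewrite IT]; move/asboolP.
Qed.

(** * The nonsplit extension attached to an arrow *)

Section NonsplitExtension.
Variables (S T : lmodType A) (f : linmap (syzygy S) T).
Hypotheses (S_simple : simple_module S) (T_simple : simple_module T).
Hypothesis not_extendable : forall g : linmap (free_mod A S) T,
  exists k, g (ker_mod_val k) <> f k.

Local Notation F := (free_mod A S).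
Local Notation evalS := (free_mod_eval S).

Lemma cocycle_neq0 : exists k, f k <> 0.
Proof. by have [k /nesym fk] := not_extendable 0; exists k. Qed.

Lemma cocycle_surj t : exists k, f k = t.
Proof.
have [k fk] := cocycle_neq0.
have [//|f0|/(_ t)[l _ fl]] := @simple_image _ _ predT f T_simple.
  by case: fk; apply: f0.
by exists l.
Qed.

(** By simplicity, f(P meet K) is 0 or T and evalS(P) is 0 or S. The pair (0, S) would extend [f] to
    F; the other pairs leave only P = ker f, K or F. *)
Lemma submods_above_cocycle_kernel (P : {pred F}) : GRing.submod_closed P ->
  (forall k, f k = 0 -> ker_mod_val k \in P) ->
  [\/ forall x, x \in P -> exists2 k, ker_mod_val k = x & f k = 0,
      forall x, x \in P <-> evalS x = 0 | P =i predT].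
Proof.
move=> PS kerP; have [P0 PL] := PS.
have PD x y : x \in P -> y \in P -> x + y \in P.
  by move=> xP yP; rewrite -[x]scale1r; apply: PL.
pose PK : {pred syzygy S} := [pred k | ker_mod_val k \in P].
have PKS : GRing.submod_closed PK.
  exact: (submod_closed_preim (ker_mod_incl evalS)).
have PK_cover x : (forall s, exists2 y, y \in P & evalS y = s) ->
    exists k : syzygy S, x - ker_mod_val k \in P.
  move=> evP; have [y yP xy] := evP (evalS x).
  have [|k kE] := (syzygyP (x - y)).1; first by rewrite raddfB /= xy subrr.
  by exists k; rewrite kE opprB addrC subrK.
have [fP|fP] := simple_image f T_simple PKS.
  have [evP|evP] := simple_image evalS S_simple PS.
    apply: Or31 => x xP; have /syzygyP[k kx] := evP x xP.
    by exists k => //; apply: fP; rewrite inE kx.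
  (* P + K = F and f vanishes on P meet K, so f extends to F by 0 on P. *)
  exfalso.
  have [|x|t [k]|g gP] := @linmap_of_graph A F T
    (fun x t => exists2 k, x - ker_mod_val k \in P & f k = t).
  - move=> a x _ y _ [k xk <-] [l yl <-]; exists (a *: k + l).
      rewrite -[ker_mod_val _]/(a *: _ + ker_mod_val l) opprD addrACA -scalerBr.
      exact: PL.
    by rewrite linearP.
  - by have [k kP] := PK_cover x evP; exists (f k), k.
  (* The value at 0 is unique: here [- k] lies in P meet K, where [f] vanishes. *)
  - move=> kP <-; have -> : k = 0 - - k by rewrite opprK add0r.
    rewrite sub0r raddfN /= fP ?oppr0 // inE /=.
    by move: kP; rewrite sub0r.
  have [k] := not_extendable g; apply; apply/gP; exists k => //.
  by rewrite subrr.
(* Now f(P meet K) = T, so each [k] differs from an element of P meet K by an element of ker f; both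
   lie in P. *)
have KP (k : syzygy S) : ker_mod_val k \in P.
  have [l lP fl] := fP (f k); rewrite -[ker_mod_val k](subrK (ker_mod_val l)).
  by apply: PD => //; apply: (kerP (k - l)); rewrite raddfB /= fl subrr.
have [evP|evP] := simple_image evalS S_simple PS.
  by apply: Or32 => x; split=> [/evP//|/syzygyP[k <-]].
apply: Or33 => x; rewrite [RHS]inE; have [k kP] := PK_cover x evP.
by rewrite -[x](subrK (ker_mod_val k)) PD.
Qed.

(** M is F / ker f, the pushout of K -> F along the surjection [f], and N is the image of K, a copy
    of T. Submodules of M pull back to submodules of F above ker f, which are already classified. *)
Lemma nonsplit_extension_exists :
  exists (M : lmodType A) (p : linmap F M) (N : {pred M}),
  [/\ forall m, exists x, p x = m,
      forall x, p x \in N <-> evalS x = 0,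
      forall k, p (ker_mod_val k) = 0 <-> f k = 0 &
      forall P : {pred M}, GRing.submod_closed P ->
        [\/ P =i pred1 0, P =i N | P =i predT]].
Proof.
pose L : {pred F} :=
  [pred x | `[< exists2 k, k \in in_kernel f & ker_mod_val k = x >]].
have LS : GRing.submod_closed L.
  exact: (submod_closed_image (ker_mod_incl evalS) (in_kernel_submod f)).
have [M [p [p_surj pL]]] := quotient_exists LS.
have p_eval x : p x = 0 -> evalS x = 0.
  by move=> /eqP; rewrite pL => /asboolP[k _ <-]; apply/syzygyP; exists k.
pose N : {pred M} :=
  [pred m | `[< exists2 x, x \in in_kernel evalS & p x = m >]].
have pN x : p x \in N <-> evalS x = 0.
  split=> [/asboolP[y /eqP y0 yx]|/eqP x0]; last by apply/asboolP; exists x.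
  rewrite -[x](subrK y) raddfD /= y0 addr0 p_eval //.
  by rewrite raddfB /= yx subrr.
have pf k : p (ker_mod_val k) = 0 <-> f k = 0.
  split=> [/eqP|/eqP fk]; last first.
    by apply/eqP; rewrite pL; apply/asboolP; exists k.
  by rewrite pL => /asboolP[l /eqP fl lk]; rewrite -(val_inj lk).
exists M, p, N; split=> // P PS.
pose PF : {pred F} := [pred x | p x \in P].
have [P0 _] := PS.
have [||PE|PE|PE] := @submods_above_cocycle_kernel PF.
- exact: submod_closed_preim.
- by move=> k /pf pk; rewrite inE pk.
- apply: Or31 => m; apply/idP/eqP => [mP|-> //].
  have [x xm] := p_surj m; rewrite -xm in mP *.
  by have [k <- /pf] := PE x mP.
- apply: Or32 => m; have [x <-] := p_surj m.
  by apply/idP/idP; [move/PE/pN|move/pN/PE].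
by apply: Or33 => m; have [x <-] := p_surj m; rewrite -[LHS]/(x \in PF) PE.
Qed.

(** The kernel and the image of a nonzero endomorphism are each 0, N or M. Going through the cases
    leaves only kernel 0 with image M; N itself shows that M is not simple. *)
Lemma division_nonsimple_of_cocycle : ~ isomorphic S T ->
  exists M, [/\ finite_length M, division_ring (endo M) & ~ simple_module M].
Proof.
move=> nST.
have [M [p [N [p_surj pN pf submods]]]] := nonsplit_extension_exists.
have NS : GRing.submod_closed N.
  split=> [|a u v]; first by rewrite -(raddf0 p); apply/pN; rewrite raddf0.
  have [[x <-] [y <-]] := (p_surj u, p_surj v) => /pN x0 /pN y0.
  by rewrite -linearP; apply/pN; rewrite linearP /= x0 y0 scaler0 addr0.
(* Two witnesses: [p (ker_mod_val k0)] is a nonzero element of N, and [p x0] lies outside N. *)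
have [k0 fk0] := cocycle_neq0.
have k0N : p (ker_mod_val k0) \in N by apply/pN/syzygyP; exists k0.
have pk0 : p (ker_mod_val k0) <> 0 by move/pf.
have [[s0 /eqP s00] _] := S_simple.
have [x0 x0s] := free_mod_eval_surj s0.
have x0N : p x0 \notin N by apply/negP => /pN; rewrite x0s.
have N_neqT : ~ (N =i predT) by move=> NT; move: x0N; rewrite NT.
have NP m : m \in N -> exists k : syzygy S, p (ker_mod_val k) = m.
  have [x <-] := p_surj m => /pN /syzygyP[k <-].
  by exists k.
exists M; split.
- exists 2, (fun i => match i return {pred M} with
    | 0%N => pred1 0 | 1%N => N | _ => predT end).
  have S0 : GRing.submod_closed (pred1 (0 : M)).
    split=> [|a u v]; rewrite !inE // => /eqP -> /eqP ->.
    by rewrite scaler0 addr0.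
  split=> // [[|[|[|i]]] //|[|[|i]] // _].
    split=> [m|/(_ (p (ker_mod_val k0)))|K KS _ KN].
    + by rewrite inE => /eqP ->; have [] := NS.
    + by rewrite k0N inE => /eqP.
    + have [||KT] := submods K KS; [by left|by right|].
      by case: N_neqT => m; apply: KN; rewrite KT.
  split=> // K KS NK _.
  have [K0||] := submods K KS; [|by left|by right].
  by case: pk0; apply/eqP; rewrite -[_ == _]K0; exact: NK.
- split.
    apply: contra_not_neq pk0 => one0.
    by rewrite -[LHS]/((1 : endo M) _) one0.
  move=> g /eqP g0.
  have kerS : GRing.submod_closed (in_kernel g) by apply: in_kernel_submod.
  pose I : {pred M} := [pred m | `[< exists2 u, u \in predT & g u = m >]].
  have IS : GRing.submod_closed I by exact: submod_closed_image.
  have gI u : g u \in I by apply/asboolP; exists u.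
  have I0 : ~ (I =i pred1 0).
    move=> I0; apply: g0; apply: linmapP => u.
    by apply/eqP; rewrite -[_ == _]I0.
  have [ker0|kerN|kerT] := submods _ kerS.
  (* An injective g cannot have image N, since g(N) would already be N. *)
  + have g_inj u v : g u = g v -> u = v.
      move=> guv; apply/subr0_eq/eqP; rewrite -[_ == _]ker0 inE.
      by rewrite raddfB /= guv subrr.
    have [IE|IE|IT] := submods _ IS; first by case: I0.
      pose J : {pred M} := [pred m | `[< exists2 u, u \in N & g u = m >]].
      have JS : GRing.submod_closed J by exact: submod_closed_image.
      have [JE|/(_ (g (p x0)))|/(_ (g (p x0)))] := submods _ JS.
      * case: pk0; apply: g_inj; rewrite raddf0; apply/eqP.
        by rewrite -[_ == _]JE; apply/asboolP; exists (p (ker_mod_val k0)).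
      * rewrite -IE gI => /asboolP[u uN /g_inj ux].
        by move: x0N; rewrite -ux uN.
      * rewrite [in X in _ = X -> _]inE => /asboolP[u uN /g_inj ux].
        by move: x0N; rewrite -ux uN.
    have [|v|v|h hg] := @linmap_of_graph A M M (fun v u => g u = v).
    * by move=> a _ u _ v <- <-; rewrite linearP.
    * by have : v \in I by [rewrite IT]; move=> /asboolP[u _ <-]; exists u.
    * by move=> gv; apply: g_inj; rewrite gv raddf0.
    exists h; split; apply: linmapP => v /=; [exact/hg|exact/hg].
  (* If g has kernel N, its image N would give S = M / N isomorphic to T, and
     image M would make the preimage of N a submodule strictly between. *)
  + exfalso; have kerE m : g m = 0 <-> m \in N.
      by rewrite -kerN inE; split=> /eqP.
    have [IE|IN|IT] := submods _ IS; first by case: I0.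
      apply: nST.
      (* The relation is the graph of the map M / N -> N induced by [g], read through M / N = S by
         [evalS] and N = T by [f]. *)
      apply: (@isomorphic_of_graph A S T (fun s t => exists x k,
        [/\ evalS x = s, f k = t & g (p x) = p (ker_mod_val k)])).
      * move=> a _ _ _ _ [x [k [<- <- xk]]] [y [l [<- <- yl]]].
        exists (a *: x + y), (a *: k + l); split; rewrite ?linearP //=.
        by rewrite xk yl.
      * move=> s; have [x <-] := free_mod_eval_surj s.
        have [|k kx] := NP (g (p x)); first by rewrite -IN gI.
        by exists (f k), x, k.
      * move=> t; have [k <-] := cocycle_surj t.
        have : p (ker_mod_val k) \in I.
          by rewrite IN; apply/pN/syzygyP; exists k.
        move=> /asboolP[m _]; have [x <-] := p_surj m => gx.
        by exists (evalS x), x, k.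
      * move=> _ [x [k [xs <- xk]]]; apply/pf; rewrite -xk.
        exact/kerE/pN.
      * move=> _ [x [k [<- /pf k0' xk]]]; apply/pN/kerE.
        by rewrite xk k0'.
    have /asboolP[u _ gu] : p (ker_mod_val k0) \in I by rewrite IT.
    pose J : {pred M} := [pred m | g m \in N].
    have JS : GRing.submod_closed J by exact: submod_closed_preim.
    have uJ : u \in J by rewrite inE gu.
    have [JE|JE|JE] := submods _ JS.
    * move: uJ; rewrite JE => /eqP u0.
      by case: pk0; rewrite -gu u0 raddf0.
    * move: uJ; rewrite JE => /kerE u0.
      by case: pk0; rewrite -gu.
    * have /asboolP[v _ gv] : p x0 \in I by rewrite IT.
      have : v \in J by rewrite JE.
      by rewrite inE gv (negPf x0N).
  + case: g0; apply: linmapP => m.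
    by have : m \in in_kernel g by [rewrite kerT]; move/eqP.
move=> [_ /(_ N NS)[N0|//]].
by move: k0N; rewrite N0 => /eqP.
Qed.

End NonsplitExtension.

(** * The equivalence over A, then over the converse ring for right modules *)

Lemma has_CSL_finite_lengthP :
  has_CSL (fun M => finite_length M) <->
  forall S T, simple_module S -> simple_module T ->
    ~ isomorphic S T -> ~ quiver_arrow S T.
Proof.
split=> [csl S T simS simT nST /quiver_arrowP[f fP]|]; last first.
  exact: has_CSL_of_no_arrow.
have [M [Mlen Mdiv []]] := division_nonsimple_of_cocycle simS simT fP nST.
exact: csl.
Qed.

End ConverseSchur.

Theorem theorem1p2 (R : pzRingType) :
  has_CSL (fun M : rmodType R => finite_length M) <->
  right_quiver_totally_disconnected R.
Proof. exact: has_CSL_finite_lengthP. Qed.
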